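(* Let $(X,d)$ be a proper, uniquely geodesic, geodesically complete metric space in which geodesics do not split, and let $I$ be an isometry of $(\mathfrak{C}(X,d),d_H)$ onto itself. Then there exists an isometry $i$ of $(X,d)$ onto itself such that $I(C)=i(C)$ for all $C\in\mathfrak{C}(X,d)$.
   Context: A metric space is proper if all its closed metric balls are compact. A geodesic of $(X,d)$ is an isometric embedding of an interval of $\mathbb{R}$ (with the metric $|\cdot|$) into $(X,d)$; a geodesic $\gamma:[a,b]\to X$ connects $\gamma(a)$ to $\gamma(b)$. $(X,d)$ is geodesic if any two points $x,y\in X$ are connected by a geodesic $\gamma_{xy}$, and uniquely geodesic if moreover this geodesic is unique (up to parametrization). A geodesic metric space is geodesically complete if for each geodesic $\gamma_{xy}$ connecting $x$ to $y$ there is a biinfinite extension, i.e. a geodesic $\gamma:(-\infty,\infty)\to X$ with $\mathrm{im}\,\gamma_{xy}\subset \mathrm{im}\,\gamma$. Geodesics do not split if for each geodesic $\gamma_{xy}$ with $x\neq y$ the image of this biinfinite extension is unique. $\mathfrak{C}(X,d)$ denotes the set of nonempty compact subsets of $(X,d)$. For $A\subset X$ and $r\ge 0$, $N_r(A)=\{x\in X\mid \exists a\in A: d(a,x)\le r\}$, and the Hausdorff metric is $d_H(A,B)=\inf\{r\mid A\subset N_r(B)\text{ and }B\subset N_r(A)\}$. *)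

(* Defs.v *)
From mathcomp Require Import all_boot all_order all_algebra.
From mathcomp Require Import classical_sets functions set_interval reals topology.

Set Implicit Arguments.
Unset Strict Implicit.
Unset Printing Implicit Defensive.

Import Order.TTheory GRing.Theory Num.Theory.
Local Open Scope classical_set_scope.
Local Open Scope ring_scope.

Section Geodesics.
Context {R : realType} {X : metricType R}.
Implicit Types (x y : X) (J : interval R) (g h : R -> X).

(* The library's [closed_ball] is the closure of the open ball, which may be
   smaller than this set in a general metric space. *)
Definition metric_closed_ball x (r : R) : set X := [set y | mdist x y <= r].

(* A geodesic with domain [J] is encoded as a function on the whole of [R];
   its values outside [J] are irrelevant. *)
Definition geodesic_on J g : Prop :=
  {in J &, forall s t, mdist (g s) (g t) = `|s - t|}.

Definition geodesic_image J g : set X := g @` [set` J].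

Definition connecting_geodesic (a b : R) g x y : Prop :=
  [/\ a <= b, geodesic_on `[a, b] g, g a = x & g b = y].

(* The parameter change [phi] is only asked to be a bijection: between
   geodesics it is then automatically an isometry of the intervals. *)
Definition same_up_to_parametrization J g J' h : Prop :=
  exists2 phi : R -> R,
    set_bij [set` J'] [set` J] phi & {in J', forall t, h t = g (phi t)}.

Definition biinfinite_extension (a b : R) g h : Prop :=
  geodesic_on `]-oo, +oo[ h /\
  geodesic_image `[a, b] g `<=` geodesic_image `]-oo, +oo[ h.

End Geodesics.

Section Spaces.
Context {R : realType} (X : metricType R).

Definition proper_space : Prop :=
  forall (x : X) (r : R), compact (metric_closed_ball x r).

Definition geodesic_space : Prop :=
  forall x y : X, exists a b g, connecting_geodesic a b g x y.

Definition uniquely_geodesic_space : Prop :=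
  geodesic_space /\
  forall (x y : X) (a b a' b' : R) (g h : R -> X),
    connecting_geodesic a b g x y -> connecting_geodesic a' b' h x y ->
    same_up_to_parametrization `[a, b] g `[a', b'] h.

Definition geodesically_complete : Prop :=
  forall (x y : X) (a b : R) (g : R -> X), connecting_geodesic a b g x y ->
    exists h, biinfinite_extension a b g h.

Definition geodesics_do_not_split : Prop :=
  forall (x y : X) (a b : R) (g : R -> X), connecting_geodesic a b g x y ->
    x <> y ->
    forall h h', biinfinite_extension a b g h -> biinfinite_extension a b g h' ->
      geodesic_image `]-oo, +oo[ h = geodesic_image `]-oo, +oo[ h'.

Definition nonempty_compacts : set (set X) :=
  [set C | C !=set0 /\ compact C].

Definition neighborhood (r : R) (A : set X) : set X :=
  [set x | exists2 a, A a & mdist a x <= r].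

Definition hausdorff_dist (A B : set X) : R :=
  inf [set r | [/\ 0 <= r, A `<=` neighborhood r B & B `<=` neighborhood r A]].

End Spaces.

(* [f] restricts to an isometry of [(D, d)] onto itself; it is a total function
   whose values outside [D] are irrelevant. *)
Definition onto_isometry (R : realType) (T : Type) (d : T -> T -> R)
    (D : set T) (f : T -> T) : Prop :=
  [/\ set_fun D D f,
      {in D &, forall x y, d (f x) (f y) = d x y}
    & set_surj D D f].

(* Main.v *)
Require Import Defs.
From mathcomp Require Import all_boot all_order all_algebra.
From mathcomp Require Import classical_sets functions set_interval reals topology.
From mathcomp Require Import boolp cardinality normedtype derive lra.

(** The isometry [i] is the action of [I] on singletons; the difficulties are
    that [I] preserves singletons at all, and that it is then determined by them.

    Two facts about the geometry of [X] are used throughout. A point between [x]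
    and [y] is determined by its distances to [x] and [y] ([between_unique]), so
    two closed balls whose radii add up to the distance of their centres meet in
    one point. And since geodesics do not split, a point [c] behind [x], as seen
    from [p], is determined by its distance to [x] ([extension_unique]).

    Singletons. If two sets inside the closed ball of radius [r] about [x] have
    Hausdorff distance at least [2 * r], then one of them has a point whose only
    antipode with respect to [x] constitutes the other, so that one of the two is
    a singleton. Hence there cannot be four such sets at mutual distance [2 * r]:
    three of them would be singletons, and a point has only one antipode. Around
    a set with two points there are four such sets for some [r], of the form
    [K], [K + p], [K + q], [K + p + q] with [p] and [q] beyond the ends of a
    diameter. So singletons are exactly the sets which are not [crowded], and
    this notion only mentions Hausdorff distances.

    Finite sets. Composing [I] with the inverse of [i] gives an isometry [J] of
    the hyperspace which fixes singletons. It fixes every finite set [A], by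
    induction on the cardinality. Let [a], [b] be a closest pair of points of
    [A], at distance [2 * rho], with midpoint [p], and let [Z] be the rest of
    [A]. Replacing [a] and [b] by one point [f] and displacing each [z] of [Z] to
    some [g z] yields a smaller set, which is fixed; so the distance from [J A]
    to all these sets is the distance from [A] to them. As every [z] may be moved
    by [rho] in any direction without leaving the [rho]-neighbourhood of [A], this
    forces [J A] to lie in the union of [Z] and the ball of radius [rho] about [p]
    ([image_subset]) and to contain [Z] ([others_in_image]). Moving [f] away
    from [p] shows that [a] and [b] belong to [J A] ([endpoint_in_image]) and
    that no other point of the sphere of radius [rho] about [p] does
    ([image_on_sphere]). The smaller sets cannot detect points of [J A] inside
    that ball; they are excluded by looking at midpoints of [J A] and a smaller
    set in the hyperspace. For [A] itself these midpoints are subsets of one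
    finite set, hence isolated from each other, whereas an interior point of the
    ball would let them vary continuously ([image_off_interior]).

    Finite sets are dense in the hyperspace, so [J] is the identity. *)

Set Implicit Arguments.
Unset Strict Implicit.
Unset Printing Implicit Defensive.

Import Order.TTheory GRing.Theory Num.Theory.
Import numFieldNormedType.Exports.
Local Open Scope classical_set_scope.
Local Open Scope ring_scope.

(** * Hausdorff distance between compact sets *)

Section Closeness.
Context {R : realType} {X : metricType R}.
Implicit Types (x y z : X) (A B C : set X) (r s t : R).

(** For nonempty compact sets this says that the Hausdorff distance is at most
    [t] ([hausdorff_distP]); working with it avoids infima. *)
Definition hausdorff_close t A B : Prop :=
  A `<=` neighborhood t B /\ B `<=` neighborhood t A.

Lemma hausdorff_close_sym t A B : hausdorff_close t A B -> hausdorff_close t B A.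
Proof. by case. Qed.

Lemma neighborhood_le s t A : s <= t -> neighborhood s A `<=` neighborhood t A.
Proof. by move=> st x [a Aa ax]; exists a => //; exact: le_trans st. Qed.

(** Every extremum needed below is that of a distance function, and these are
    1-Lipschitz. *)
Lemma lipschitz_attains_max (f : X -> R) A : A !=set0 -> compact A ->
  (forall x y, f x - f y <= mdist x y) ->
  exists2 c, A c & forall x, A x -> f x <= f c.
Proof.
move=> A0 cA lipf.
have cf : continuous f.
  move=> x; apply/cvgrPdist_lt => e e0.
  near=> y.
  have xy : mdist x y < e.
    by near: y; apply/metricType_numDomainType.nbhs_mdistP; exists e.
  rewrite ltr_norml; have := lipf x y; have := lipf y x.
  by rewrite [mdist y x]metric_sym; lra.
have [c cA' maxc] := compact_EVT_max A0 cA (continuous_subspaceT cf).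
by exists c; [rewrite inE in cA'|move=> x Ax; apply: maxc; rewrite inE].
Unshelve. all: by end_near.
Qed.

Lemma mdist_lipschitz x y z : mdist x z - mdist y z <= mdist x y.
Proof. by rewrite lerBlDr metric_triangle. Qed.

Lemma farthest_point A x : nonempty_compacts A ->
  exists2 a, A a & forall y, A y -> mdist y x <= mdist a x.
Proof.
move=> [A0 cA]; apply: (lipschitz_attains_max A0 cA) => y z.
exact: mdist_lipschitz.
Qed.

Lemma nearest_point A x : nonempty_compacts A ->
  exists2 a, A a & forall y, A y -> mdist a x <= mdist y x.
Proof.
move=> [A0 cA].
have [y z|a Aa maxa] := @lipschitz_attains_max (fun y => - mdist y x) A A0 cA.
  by have := mdist_lipschitz z y x; rewrite [mdist z y]metric_sym; lra.
by exists a => // y /maxa; rewrite lerN2.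
Qed.

Lemma not_in_neighborhood r A x : nonempty_compacts A ->
  ~ neighborhood r A x -> exists2 s, r < s & forall a, A a -> s <= mdist a x.
Proof.
move=> /(nearest_point x)[a Aa mina] nx; exists (mdist a x) => //.
by rewrite ltNge; apply/negP => ax; apply: nx; exists a.
Qed.

Lemma closed_neighborhood r A : nonempty_compacts A -> closed (neighborhood r A).
Proof.
move=> cA x clx; apply: contrapT => /(not_in_neighborhood cA)[s rs mins].
have [y [[a Aa ay] xy]] : neighborhood r A `&` [set y | mdist x y < s - r] !=set0.
  apply: clx; apply/metricType_numDomainType.nbhs_mdistP.
  by exists (s - r) => //=; lra.
have := mins _ Aa; have := metric_triangle a y x.
by rewrite /= [mdist x y]metric_sym in xy; lra.
Qed.

Lemma in_neighborhood_lim r A x : nonempty_compacts A ->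
  (forall s, r < s -> neighborhood s A x) -> neighborhood r A x.
Proof.
move=> cA H; apply: contrapT => /(not_in_neighborhood cA)[s rs mins].
by have [|a Aa] := H ((r + s) / 2); [lra|have := mins _ Aa; lra].
Qed.

Lemma hausdorff_close_bounded A B : nonempty_compacts A -> nonempty_compacts B ->
  exists t, hausdorff_close t A B.
Proof.
move=> cA cB; have [[a Aa] _] := cA; have [[b Bb] _] := cB.
have [a' _ ha] := farthest_point b cA; have [b' _ hb] := farthest_point a cB.
exists (Num.max (mdist a' b) (mdist b' a)); split=> x Hx.
- by exists b => //; rewrite metric_sym le_max ha.
- by exists a => //; rewrite metric_sym le_max hb ?orbT.
Qed.

(** The infimum is over a nonempty set because compact sets are bounded, and it
    is attained because neighbourhoods of compact sets are closed. *)
Lemma hausdorff_distP t A B : nonempty_compacts A -> nonempty_compacts B ->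
  hausdorff_dist A B <= t <-> hausdorff_close t A B.
Proof.
move=> cA cB; rewrite /hausdorff_dist; set S := [set r | _].
have [[a Aa] _] := cA.
have S_ge0 : lbound S 0 by move=> r [].
have close_ge0 r : hausdorff_close r A B -> 0 <= r.
  by move=> [/(_ _ Aa)[b _ +] _]; apply: le_trans; exact: mdist_ge0.
have infS : has_inf S.
  split; last by exists 0.
  have [r Hr] := hausdorff_close_bounded cA cB.
  by exists r; split; [exact: close_ge0|case: Hr|case: Hr].
split=> [infle|Ht]; last first.
  apply: ge_inf; first by exists 0.
  by split; [exact: close_ge0|case: Ht|case: Ht].
have cl s : t < s -> hausdorff_close s A B.
  move=> ts; have [|r [_ AB BA] rs] := @inf_adherent _ S (s - inf S) _ infS.
    by lra.
  have {}rs : r <= s by lra.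
  by split=> x Hx; apply: (neighborhood_le rs); [exact: AB|exact: BA].
by split=> x Hx; apply: in_neighborhood_lim => // s /cl[AB BA];
  [exact: AB|exact: BA].
Qed.

(** The point of [A] farthest from [B] realizes the one-sided distance, since
    the distance to [B] is 1-Lipschitz. *)
Lemma far_point_of_subset A B t : nonempty_compacts A -> nonempty_compacts B ->
  (forall s, s < t -> ~ A `<=` neighborhood s B) ->
  exists2 a, A a & forall b, B b -> t <= mdist a b.
Proof.
move=> [A0 cA] cB far.
have /choice[near nearP] : forall x,
    exists b, B b /\ forall y, B y -> mdist b x <= mdist y x.
  by move=> x; have [b Bb Hb] := nearest_point x cB; exists b.
have [x y|a Aa amax] := @lipschitz_attains_max (fun x => mdist (near x) x) A A0 cA.
  have [Bx _] := nearP y; have [_ /(_ _ Bx)] := nearP x.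
  by have := metric_triangle (near y) y x; rewrite [mdist y x]metric_sym; lra.
exists a => // b Bb; rewrite metric_sym.
have [_ /(_ _ Bb)] := nearP a; apply: le_trans; rewrite leNgt; apply/negP => lt.
apply: (far _ lt) => x Ax; exists (near x); first by have [] := nearP x.
exact: amax.
Qed.

(** For nonempty compact sets, a Hausdorff distance of at least [t]. *)
Definition hausdorff_far t A B : Prop := forall s, s < t -> ~ hausdorff_close s A B.

Lemma hausdorff_far_sym t A B : hausdorff_far t A B -> hausdorff_far t B A.
Proof. by move=> far s /far nAB /hausdorff_close_sym. Qed.

Lemma hausdorff_far_point A B t : nonempty_compacts A -> nonempty_compacts B ->
  hausdorff_far t A B ->
  (exists2 a, A a & forall b, B b -> t <= mdist a b) \/
  (exists2 b, B b & forall a, A a -> t <= mdist b a).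
Proof.
move=> cA cB far.
have [[s st AB]|AB] := pselect (exists2 s, s < t & A `<=` neighborhood s B); last first.
  left; apply: far_point_of_subset => // s st sub; apply: AB; by exists s.
right; apply: far_point_of_subset => // s' s't BA.
apply: (far (Num.max s s')); first by rewrite gt_max st.
split=> x.
- by move=> /AB; apply: neighborhood_le; rewrite le_max lexx.
- by move=> /BA; apply: neighborhood_le; rewrite le_max lexx orbT.
Qed.

Lemma hausdorff_far_intro A B t a :
  A a -> (forall b, B b -> t <= mdist a b) -> hausdorff_far t A B.
Proof.
move=> Aa far s st [/(_ _ Aa)[b Bb +] _]; have := far _ Bb.
by rewrite [mdist b a]metric_sym; lra.
Qed.

Lemma hausdorff_close_eq A B : nonempty_compacts A -> nonempty_compacts B ->
  (forall e, 0 < e -> hausdorff_close e A B) -> A = B.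
Proof.
have sub A' B' : nonempty_compacts B' ->
    (forall e, 0 < e -> hausdorff_close e A' B') -> A' `<=` B'.
  move=> cB cl x Ax; have [b Bb] : neighborhood 0 B' x.
    by apply: in_neighborhood_lim => // s /cl[+ _]; apply.
  move=> bx; suff -> : x = b by [].
  by apply/esym/mdist_positivity/eqP; rewrite eq_le bx mdist_ge0.
move=> cA cB cl; apply/seteqP; split; apply: sub => // e /cl //.
exact: hausdorff_close_sym.
Qed.

End Closeness.

(** * Lines in a space whose geodesics extend uniquely *)

Section Geometry.
Context {R : realType} {X : metricType R}.
Hypothesis X_uniquely_geodesic : uniquely_geodesic_space X.
Hypothesis X_geodesically_complete : geodesically_complete X.
Hypothesis X_no_split : geodesics_do_not_split X.
Implicit Types (x y z p c m : X) (s t : R).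

(** A biinfinite extension of a geodesic from [x] to [y], with its parameter
    shifted and possibly reversed. *)
Lemma line_through x y : exists h : R -> X,
  [/\ forall s t, mdist (h s) (h t) = `|s - t|, h 0 = x & h (mdist x y) = y].
Proof.
have [a [b [g cg]]] := X_uniquely_geodesic.1 x y.
have [h [gh sub]] := X_geodesically_complete cg.
have [ab _ ga gb] := cg.
have dh s t : mdist (h s) (h t) = `|s - t| by apply: gh; rewrite in_itv.
have [s _ hs] : geodesic_image `]-oo, +oo[ h x.
  by apply: sub; exists a => //=; rewrite in_itv /= lexx.
have [t _ ht] : geodesic_image `]-oo, +oo[ h y.
  by apply: sub; exists b => //=; rewrite in_itv /= lexx andbT.
have dxy : mdist x y = `|s - t| by rewrite -hs -ht dh.
have [st|ts] := leP s t.
- exists (fun u => h (s + u)); split=> [u v||]; last 2 first.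
  + by rewrite addr0.
  + by rewrite dxy distrC ger0_norm ?subr_ge0// subrKC.
  + by rewrite dh; congr `|_|; lra.
- exists (fun u => h (s - u)); split=> [u v||]; last 2 first.
  + by rewrite subr0.
  + by rewrite dxy ger0_norm ?subr_ge0 1?ltW// subKr.
  + by rewrite dh distrC; congr `|_|; lra.
Qed.

Lemma point_on_ray x y t : 0 <= t ->
  exists z, mdist x z = t /\ mdist z y = `|mdist x y - t|.
Proof.
have [h [dh h0 hd]] := line_through x y => t0; exists (h t); split.
  by rewrite -{1}h0 dh sub0r normrN ger0_norm.
by rewrite -{1}hd dh distrC.
Qed.

Lemma extend_geodesic x y t : 0 <= t ->
  exists z, mdist y z = t /\ mdist x z = mdist x y + t.
Proof.
have [h [dh h0 hd]] := line_through x y => t0; exists (h (mdist x y + t)); split.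
  by rewrite -{1}hd dh opprD addNKr normrN ger0_norm.
by rewrite -{1}h0 dh sub0r normrN ger0_norm// addr_ge0// mdist_ge0.
Qed.

Lemma midpoint x y :
  exists m, mdist x m = mdist x y / 2 /\ mdist m y = mdist x y / 2.
Proof.
have d0 := mdist_ge0 x y.
have [|m [xm my]] := @point_on_ray x y (mdist x y / 2); first lra.
by exists m; split=> //; rewrite my ger0_norm; lra.
Qed.

(** Geodesics from [x] to [m] and from [m] to [y] fit together into a geodesic
    because the triangle inequality is an equality at [m]. *)
Lemma geodesic_through x m y : mdist x m + mdist m y = mdist x y ->
  exists2 g, connecting_geodesic 0 (mdist x y) g x y & g (mdist x m) = m.
Proof.
move=> xmy; have [g1 [d1 g10 g1m]] := line_through x m.
have [g2 [d2 g20 g2y]] := line_through m y.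
have xm0 := mdist_ge0 x m; have my0 := mdist_ge0 m y.
pose g t := if t <= mdist x m then g1 t else g2 (t - mdist x m).
have g_cross s t : 0 <= s -> s <= mdist x m -> mdist x m < t -> t <= mdist x y ->
    mdist (g1 s) (g2 (t - mdist x m)) = t - s.
  move=> s0 sm mt ty.
  have e1 : mdist x (g1 s) = s by rewrite -{1}g10 d1 sub0r normrN ger0_norm.
  have e2 : mdist (g1 s) m = mdist x m - s.
    by rewrite -{1}g1m d1 distrC ger0_norm//; lra.
  have e3 : mdist m (g2 (t - mdist x m)) = t - mdist x m.
    by rewrite -{1}g20 d2 sub0r normrN ger0_norm//; lra.
  have e4 : mdist (g2 (t - mdist x m)) y = mdist x y - t.
    by rewrite -{1}g2y d2 distrC ger0_norm//; lra.
  have := metric_triangle (g1 s) m (g2 (t - mdist x m)).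
  have := metric_triangle x (g1 s) y.
  have := metric_triangle (g1 s) (g2 (t - mdist x m)) y; lra.
exists g; last by rewrite /g lexx.
split; first exact: mdist_ge0.
- move=> s t; rewrite !in_itv /= => /andP[s0 sy] /andP[t0 ty].
  rewrite /g; have [sm|ms] := leP s (mdist x m); have [tm|mt] := leP t (mdist x m).
  + exact: d1.
  + by rewrite g_cross// distrC ger0_norm//; lra.
  + by rewrite metric_sym g_cross// ger0_norm//; lra.
  + by rewrite d2; congr `|_|; lra.
- by rewrite /g xm0.
- rewrite /g; case: ifP => [ym|_]; last by rewrite -xmy addrC addKr.
  have y_m : m = y by apply/mdist_positivity; lra.
  by rewrite -y_m g1m.
Qed.

(** The geodesics from [x] to [y] through [m] and through [m'] differ by a change
    of parameter [phi]. As [m'] has the same distance to [x] as [m], [phi] fixes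
    this distance. *)
Lemma between_unique x y m m' : mdist x m + mdist m y = mdist x y ->
  mdist x m' = mdist x m -> mdist m' y = mdist m y -> m = m'.
Proof.
move=> xmy xm' m'y.
have [g cg gm] := geodesic_through xmy.
have [|g' cg' gm'] := @geodesic_through x m' y; first by rewrite xm' m'y.
have [phi [phiJ _ _] phiE] := X_uniquely_geodesic.2 _ _ _ _ _ _ _ _ cg cg'.
have xm0 := mdist_ge0 x m; have my0 := mdist_ge0 m y.
have mJ : mdist x m \in `[0, mdist x y] by rewrite in_itv /= xm0 -xmy lerDl.
have [_ gJ g0 _] := cg.
have phimJ : phi (mdist x m) \in `[0, mdist x y] by exact: phiJ.
have m'E : m' = g (phi (mdist x m)) by rewrite -(phiE _ mJ) -[LHS]gm' xm'.
suff e : phi (mdist x m) = mdist x m by rewrite m'E e gm.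
have zJ : 0 \in `[0, mdist x y] by rewrite in_itv /= lexx mdist_ge0.
have := gJ _ _ zJ phimJ; rewrite g0 -m'E xm' sub0r normrN => e; apply/esym.
by rewrite [LHS]e; move: phimJ; rewrite in_itv => /andP[/ger0_norm].
Qed.

(** The lines through [p] and [c] and through [p] and [c'] both extend the
    geodesic from [p] to [x]; as geodesics do not split, they have the same image,
    and the position of a point on it is determined by its distances to [p] and
    [x]. *)
Lemma extension_unique p x c c' : p != x ->
  mdist p c = mdist p x + mdist x c -> mdist p c' = mdist p x + mdist x c' ->
  mdist x c = mdist x c' -> c = c'.
Proof.
move=> px pc pc' cc'.
have d0 : 0 < mdist p x by rewrite mdist_gt0.
have [h [dh h0 hc]] := line_through p c.
have [h' [dh' h'0 h'c]] := line_through p c'.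
have agree t : 0 <= t -> t <= mdist p x -> h t = h' t.
  have line_x k e : (forall s t, mdist (k s) (k t) = `|s - t|) -> k 0 = p ->
      k (mdist p e) = e -> mdist p e = mdist p x + mdist x e -> k (mdist p x) = x.
    move=> dk k0 ke pe; have e0 := mdist_ge0 x e.
    apply/esym/(@between_unique p e); first by rewrite pe.
      by rewrite -{1}k0 dk sub0r normrN ger0_norm// ltW.
    by rewrite -{1}ke dk distrC ger0_norm; lra.
  have hx := line_x _ _ dh h0 hc pc; have h'x := line_x _ _ dh' h'0 h'c pc'.
  move=> t0 tx; apply: (@between_unique p x).
  - have e1 : mdist p (h t) = t by rewrite -h0 dh sub0r normrN ger0_norm.
    have e2 : mdist (h t) x = mdist p x - t.
      by rewrite -[X in mdist _ X]hx dh distrC ger0_norm ?subr_ge0.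
    by rewrite e1 e2; lra.
  - by have := dh 0 t; rewrite -(dh' 0 t) h0 h'0.
  - by have := dh t (mdist p x); rewrite -(dh' t) hx h'x.
have cg : connecting_geodesic 0 (mdist p x) h p (h (mdist p x)).
  by split=> //; exact: ltW.
have pneq : p <> h (mdist p x).
  have := dh 0 (mdist p x); rewrite h0 => + e; rewrite -e mdistxx.
  by rewrite sub0r normrN ger0_norm ?ltW// => e'; rewrite -e' ltxx in d0.
have ext k : (forall s t, mdist (k s) (k t) = `|s - t|) ->
    (forall t, 0 <= t -> t <= mdist p x -> h t = k t) ->
    biinfinite_extension 0 (mdist p x) h k.
  move=> dk hk; split; first by move=> s t _ _; exact: dk.
  move=> _ [t /= + <-]; rewrite in_itv => /andP[t0 tx].
  by exists t; rewrite ?hk//= in_itv.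
have := X_no_split cg pneq (ext _ dh (fun _ _ _ => erefl)) (ext _ dh' agree).
move=> /seteqP[/(_ c) hh' _].
have [|t _ h't] := hh'; first by exists (mdist p c) => //=; rewrite in_itv.
have h'x : h' (mdist p x) = x.
  rewrite -agree ?lexx ?ltW//; apply/esym/(@between_unique p c); first by rewrite pc.
    by rewrite -{1}h0 dh sub0r normrN ger0_norm// ltW.
  by rewrite -{1}hc dh distrC ger0_norm; have := mdist_ge0 x c; lra.
have := dh' 0 t; rewrite h'0 h't sub0r normrN.
have := dh' (mdist p x) t; rewrite h'x h't => xt pt.
rewrite -h't -h'c; congr h'.
have xc0 := mdist_ge0 x c.
by move: xt pt; case: ltrgt0P => ?; case: ltrgt0P => ?; lra.
Qed.

End Geometry.

(** * A metric characterization of singletons *)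

Section Singletons.
Context {R : realType} {X : metricType R}.
Hypothesis X_proper : proper_space X.
Hypothesis X_uniquely_geodesic : uniquely_geodesic_space X.
Hypothesis X_geodesically_complete : geodesically_complete X.
Hypothesis X_no_split : geodesics_do_not_split X.
Implicit Types (x y z p c m : X) (s t r : R) (A B C : set X).

Let extend := extend_geodesic X_uniquely_geodesic X_geodesically_complete.
Let ext_unique := extension_unique X_uniquely_geodesic X_geodesically_complete
  X_no_split.

Lemma closed_far_from p t : closed [set x | t <= mdist x p].
Proof.
move=> x clx; rewrite /= leNgt; apply/negP => xp.
have [y [/= yp xy]] : [set x | t <= mdist x p] `&`
    [set y | mdist x y < t - mdist x p] !=set0.
  apply: clx; apply/metricType_numDomainType.nbhs_mdistP.
  by exists (t - mdist x p) => //=; lra.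
by have := metric_triangle y x p; rewrite [mdist y x]metric_sym; lra.
Qed.

(** Properness makes the auxiliary sets of the proof compact. *)
Lemma compact_in_neighborhood r A S : nonempty_compacts A -> closed S ->
  S `<=` neighborhood r A -> compact S.
Proof.
move=> cA clS SA; have [[a Aa] _] := cA; have [b _ bmax] := farthest_point a cA.
apply: (subclosed_compact clS (@X_proper a (mdist b a + r))) => x /SA[c Ac cx].
have := bmax _ Ac; have := metric_triangle a c x.
by rewrite /= /metric_closed_ball /= [mdist a c]metric_sym; lra.
Qed.

Lemma nonempty_compacts1 x : nonempty_compacts [set x].
Proof. by split; [exists x|exact: compact_set1]. Qed.

(** The property that tells other compact sets from singletons. It is expressed
    through Hausdorff distances alone, so that isometries of the hyperspace
    respect it. The index of a set is meant to tell which of two extra points it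
    contains. *)
Definition crowded A : Prop := exists r (U : bool * bool -> set X),
  [/\ 0 < r, forall i, nonempty_compacts (U i),
      forall i, hausdorff_close r (U i) A
    & forall i j, i <> j -> hausdorff_far (2 * r) (U i) (U j)].

(** A point [u] of one set at distance at least [2 * r] from all of the other
    has [x] as midpoint with each point of the other, so the other set is the
    antipode of [u]. *)
Lemma far_sets_near_point r x A B : 0 < r ->
  nonempty_compacts A -> nonempty_compacts B ->
  hausdorff_close r A [set x] -> hausdorff_close r B [set x] ->
  hausdorff_far (2 * r) A B ->
  (exists2 v, mdist x v = r & A = [set v]) \/
  (exists2 v, mdist x v = r & B = [set v]).
Proof.
move=> r0 cA cB [Ax _] [Bx _].
have radius C y : C `<=` neighborhood r [set x] -> C y -> mdist x y <= r.
  by move=> Cx /Cx[_ ->].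
have key C D u : nonempty_compacts D -> C `<=` neighborhood r [set x] ->
    D `<=` neighborhood r [set x] -> C u ->
    (forall v, D v -> 2 * r <= mdist u v) ->
    exists2 v, mdist x v = r & D = [set v].
  move=> [[v Dv] _] Cx Dx Cu uD; have xu := radius _ _ Cx Cu.
  have opposite w : D w -> [/\ mdist u x = r, mdist x w = r & mdist u w = 2 * r].
    move=> Dw; have := uD _ Dw; have := radius _ _ Dx Dw.
    by have := metric_triangle u x w; rewrite [mdist u x]metric_sym; split; lra.
  have [ux xv uv] := opposite _ Dv; exists v => //.
  apply/seteqP; split=> [w Dw|_ ->//]; have [_ xw uw] := opposite _ Dw.
  have ux0 : u != x by rewrite -mdist_gt0 ux.
  by apply: (ext_unique ux0); lra.
move=> /(hausdorff_far_point cA cB)[[u Au uB]|[u Bu uA]].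
  by right; exact: key cB Ax Bx Au uB.
by left; exact: key cA Bx Ax Bu uA.
Qed.

(** At most one of the four sets fails to be a singleton, and three mutually
    antipodal points cannot exist. *)
Lemma singleton_not_crowded x : ~ crowded [set x].
Proof.
move=> [r [U [r0 cU closeU farU]]].
pose S i := exists2 v, mdist x v = r & U i = [set v].
have two i j : i <> j -> S i \/ S j.
  by move=> ij; apply: (far_sets_near_point r0 _ _ _ _ (farU _ _ ij)).
have three i j k : i <> j -> i <> k -> j <> k -> S i -> S j -> S k -> False.
  move=> ij ik jk [u xu Ui] [v xv Uj] [w xw Uk].
  have apart y z (l n : bool * bool) : U l = [set y] -> U n = [set z] -> l <> n ->
      2 * r <= mdist y z.
    move=> Ul Um /farU; rewrite Ul Um.
    move=> /(hausdorff_far_point (nonempty_compacts1 y) (nonempty_compacts1 z)).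
    by case=> -[_ -> /(_ _ erefl)//]; rewrite metric_sym.
  have uv := apart _ _ _ _ Ui Uj ij; have uw := apart _ _ _ _ Ui Uk ik.
  have vw := apart _ _ _ _ Uj Uk jk.
  have ux0 : u != x by rewrite -mdist_gt0 metric_sym xu.
  have tv := metric_triangle u x v; have tw := metric_triangle u x w.
  rewrite [mdist u x]metric_sym in tv tw.
  have vw0 : v = w by apply: (ext_unique ux0); rewrite ?[mdist u x]metric_sym; lra.
  by move: vw; rewrite vw0 mdistxx; lra.
pose a := (true, true); pose b := (true, false); pose c := (false, true).
pose d := (false, false).
have one i j : i <> j -> ~ S i -> S j by move=> /two[].
have [Sa|nSa] := pselect (S a); last first.
  by apply: (three b c d) => //; apply: (one a).
have [Sb|nSb] := pselect (S b); last first.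
  by apply: (three a c d) => //; apply: (one b).
have [Sc|Sd] : S c \/ S d by exact: two.
  exact: (three a b c).
exact: (three a b d).
Qed.

Lemma diameter_attained A : nonempty_compacts A ->
  exists a b, [/\ A a, A b & forall x y, A x -> A y -> mdist x y <= mdist a b].
Proof.
move=> cA; have [A0 cptA] := cA.
have /choice[far farP] : forall x,
    exists a, A a /\ forall y, A y -> mdist y x <= mdist a x.
  by move=> x; have [a Aa Ha] := farthest_point x cA; exists a.
have [x y|b Ab bmax] := @lipschitz_attains_max _ _ (fun x => mdist (far x) x) A A0 cptA.
  have [Ax _] := farP x; have [_ /(_ _ Ax)] := farP y.
  by have := metric_triangle (far x) y x; rewrite [mdist y x]metric_sym; lra.
exists (far b), b; split=> //; first by have [] := farP b.
by move=> x y Ax Ay; have [_ /(_ _ Ax)] := farP y; have := bmax _ Ay; lra.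
Qed.

(** Let [a], [b] realize the diameter of [A], let [r] be half of it, and let [p]
    and [q] lie at distance [r] beyond [a] and [b]. They are at distance at least
    [r] from every point of [A], so that each point of [A] can be pushed by at
    most [r] to distance [2 * r] from [p] and [q]; as [p] and [q] are [4 * r]
    apart, pushing away from one does not come too close to the other. The
    resulting set [K] may be completed by [p], by [q], by both or by none, and
    each choice is visible at distance [2 * r]. *)
Lemma crowded_of_two_points A a b : nonempty_compacts A -> A a -> A b -> a != b ->
  crowded A.
Proof.
move=> cA; wlog amax : a b / forall x y, A x -> A y -> mdist x y <= mdist a b.
  move=> wlog_ Aa Ab ab; have [a' [b' [Aa' Ab' max']]] := diameter_attained cA.
  apply: (wlog_ a' b') => //; rewrite -mdist_gt0.
  by apply: lt_le_trans (max' _ _ Aa Ab); rewrite mdist_gt0.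
move=> Aa Ab; rewrite -mdist_gt0 => ab0.
pose r := mdist a b / 2; have r0 : 0 < r by rewrite /r; lra.
have abr : mdist a b = 2 * r by rewrite /r; lra.
have [p [ap bp]] := extend b a (ltW r0); have [q [bq pq]] := extend p b (ltW r0).
rewrite [mdist b a]metric_sym in bp; rewrite [mdist p b]metric_sym in pq.
have pqr : mdist p q = 4 * r by rewrite pq bp abr; lra.
have farp x : A x -> r <= mdist x p.
  move=> Ax; have := amax _ _ Ab Ax; have := metric_triangle b x p; lra.
have farq x : A x -> r <= mdist x q.
  move=> Ax; have := amax _ _ Ax Aa; have := metric_triangle p a x.
  have := metric_triangle p x q;
  rewrite [mdist p a]metric_sym [mdist a x]metric_sym; lra.
pose K := neighborhood r A `&` [set x | 2 * r <= mdist x p]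
  `&` [set x | 2 * r <= mdist x q].
have pushed x p' q' : A x -> r <= mdist x p' -> mdist x p' < 2 * r ->
    mdist p' q' = 4 * r ->
    exists z, [/\ mdist x z <= r, 2 * r <= mdist z p' & 2 * r <= mdist z q'].
  move=> Ax xp' px' p'q'.
  have [|z [xz pz]] := @extend p' x (2 * r - mdist x p'); first lra.
  exists z; rewrite [mdist z p']metric_sym pz [mdist p' x]metric_sym xz; split; try lra.
  have := metric_triangle p' z q'; rewrite pz [mdist p' x]metric_sym; lra.
have AK : A `<=` neighborhood r K.
  move=> x Ax.
  have inK z : mdist x z <= r -> 2 * r <= mdist z p -> 2 * r <= mdist z q ->
      neighborhood r K x.
    move=> xz zp zq; exists z; last by rewrite metric_sym.
    by split=> //; split=> //; exists x.
  have [xp|xp] := ltP (mdist x p) (2 * r).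
    by have [z [? ? ?]] := pushed x p q Ax (farp _ Ax) xp pqr; exact: (inK z).
  have [xq|xq] := ltP (mdist x q) (2 * r).
    rewrite metric_sym in pqr.
    by have [z [? ? ?]] := pushed x q p Ax (farq _ Ax) xq pqr; exact: (inK z).
  by apply: (inK x) => //; rewrite mdistxx ltW.
have cK : compact K.
  apply: (@compact_in_neighborhood r A) => //; last by move=> x [[]].
  by repeat apply: closedI; [exact: closed_neighborhood| |]; exact: closed_far_from.
have K0 : K !=set0 by have [k Kk _] := AK _ Aa; exists k.
pose U (i : bool * bool) := K `|` [set x | x = p /\ i.1] `|` [set x | x = q /\ i.2].
have KU i : K `<=` U i by move=> x Kx; left; left.
have farU u i j : (u = p \/ u = q) -> U i u -> (forall y, U j y -> y = u -> False) ->
    hausdorff_far (2 * r) (U i) (U j).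
  move=> upq Uu nU; apply: (hausdorff_far_intro Uu) => y Uy; rewrite metric_sym.
  have [[[[_ yp] yq]|[yp _]]|[yq _]] := Uy.
  - by case: upq => ->.
  - case: upq => uE; last by rewrite yp uE; lra.
    by case: (nU _ Uy); rewrite yp.
  - case: upq => uE; first by rewrite yq uE metric_sym; lra.
    by case: (nU _ Uy); rewrite yq.
have p_neq_q : p <> q by move=> pE; move: pqr; rewrite pE mdistxx; lra.
have nKp : ~ K p by move=> [[_ /=]]; rewrite mdistxx; lra.
have nKq : ~ K q by move=> [_ /=]; rewrite mdistxx; lra.
have diff i j : i.1 && ~~ j.1 || i.2 && ~~ j.2 -> hausdorff_far (2 * r) (U i) (U j).
  case/orP=> /andP[ii /negP nj].
  - apply: (farU p); [by left|by left; right|].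
    move=> y [[Ky|[_ //]]|[yq _]] yp; first by apply: nKp; rewrite -yp.
    by apply: p_neq_q; rewrite -yp.
  - apply: (farU q); [by right|by right|].
    move=> y [[Ky|[yp _]]|[_ //]] yq; first by apply: nKq; rewrite -yq.
    by apply: p_neq_q; rewrite -yp.
exists r, U; split=> // [i|i|i j ij].
- split; first by have [k Kk] := K0; exists k; exact: KU.
  have c1 z (b0 : bool) : compact [set x | x = z /\ b0].
    apply: finite_compact; apply: (@sub_finite_set _ _ [set z]) => [x []//|].
    exact: finite_set1.
  by repeat apply: compactU.
- split; last by move=> x /AK[k Kk kx]; exists k => //; exact: KU.
  move=> x [[[[Ax _] _]|[-> _]]|[-> _]] //.
    by exists a => //; rewrite ap.
  by exists b => //; rewrite bq.
- case: i j ij => [[] []] [[] []] // ij; try (by case: ij); try exact: diff.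
  all: by apply: hausdorff_far_sym; exact: diff.
Qed.

End Singletons.

(** * Hyperspace isometries that fix singletons *)

Section FiniteSets.
Context {R : realType} {X : metricType R}.
Hypothesis X_proper : proper_space X.
Hypothesis X_uniquely_geodesic : uniquely_geodesic_space X.
Hypothesis X_geodesically_complete : geodesically_complete X.
Hypothesis X_no_split : geodesics_do_not_split X.
Implicit Types (x y z p c m : X) (s t r : R) (A B C : set X).

Let line := line_through X_uniquely_geodesic X_geodesically_complete.
Let ray_point := point_on_ray X_uniquely_geodesic X_geodesically_complete.
Let extend := extend_geodesic X_uniquely_geodesic X_geodesically_complete.
Let mid := midpoint X_uniquely_geodesic X_geodesically_complete.
Let mid_unique := between_unique X_uniquely_geodesic X_geodesically_complete.
Let ext_unique := extension_unique X_uniquely_geodesic X_geodesically_complete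
  X_no_split.

Lemma nonempty_compacts_seq x (u : seq X) : nonempty_compacts [set` x :: u].
Proof.
split; first by exists x; rewrite /= mem_head.
by apply: finite_compact; exact: finite_seq.
Qed.


(** The finite subsets of [C] are directed by inclusion; a property which holds
    near each point of a compact set for all large enough of them holds on the
    whole set for one of them. *)
Lemma finite_net C e : nonempty_compacts C -> 0 < e ->
  exists x (u : seq X), hausdorff_close e C [set` x :: u].
Proof.
move=> [[x Cx] cptC] e0.
pose above (u v : seq X) := {subset u <= v} /\ {subset v <= C}.
pose G := filter_from [set u : seq X | {subset u <= C}] above.
have filterG : Filter G.
  apply: filter_from_filter; first by exists [::].
  move=> u v uC vC; exists (u ++ v).
    by move=> y; rewrite mem_cat => /orP[/uC|/vC].
  move=> w [uvw wC]; split; split=> // y yu; apply: uvw; rewrite mem_cat yu ?orbT//.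
pose near_some (u : seq X) y := exists2 z, z \in u & mdist z y < e.
have /(compact_near_coveringP C).1/(_ _ G near_some filterG) := cptC.
case=> [c Cc|u uC net].
  exists ([set y | mdist c y < e], [set u | above [:: c] u]) => /=.
    split; first by apply/metricType_numDomainType.nbhs_mdistP; exists e.
    by exists [:: c] => //= y; rewrite mem_seq1 => /eqP->; rewrite inE.
  by move=> [y u] [/= cy [/(_ c) cu _]]; exists c; rewrite ?cu ?mem_seq1.
exists x, u; split=> y.
- move=> Cy; have [z zu zy] := net u (conj (fun _ => id) uC) y Cy.
  by exists z; [rewrite /= inE zu orbT|exact: ltW].
- rewrite /= inE => /orP[/eqP->|yu]; first by exists x; rewrite ?mdistxx ?ltW.
  by exists y; [have := uC _ yu; rewrite inE|rewrite mdistxx ltW].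
Qed.

Lemma seq_argmin (T : eqType) (f : T -> R) (u : seq T) : u != [::] ->
  exists2 i, i \in u & forall j, j \in u -> f i <= f j.
Proof.
elim: u => // i [_ _|k u IH _].
  by exists i => [|j]; rewrite mem_seq1 // => /eqP->.
have [//|m mu mmin] := IH; have [im|mi] := leP (f i) (f m).
  exists i; first exact: mem_head.
  by move=> j; rewrite inE => /orP[/eqP->//|/mmin]; apply: le_trans.
exists m; first by rewrite inE mu orbT.
by move=> j; rewrite inE => /orP[/eqP->|/mmin//]; exact: ltW.
Qed.


Lemma closest_pair (u : seq X) x y : x \in u -> y \in u -> x != y ->
  exists a b, [/\ a \in u, b \in u, a != b &
    forall z w, z \in u -> w \in u -> z != w -> mdist a b <= mdist z w].
Proof.
move=> xu yu xy.
pose P := [seq q <- [seq (z, w) | z <- u, w <- u] | q.1 != q.2].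
have inP z w : (z, w) \in P = [&& z != w, z \in u & w \in u].
  rewrite mem_filter /=; congr (_ && _).
  by apply/allpairsP/andP => [[[z' w'] /= [? ? [-> ->]]]|[? ?]] //; exists (z, w).
have [|[a b] abP abmin] := @seq_argmin _ (fun q => mdist q.1 q.2) P.
  by apply/eqP => P0; have := inP x y; rewrite P0 xy xu yu.
move: (abP); rewrite inP => /and3P[ab au bu]; exists a, b; split=> // z w zu wu zw.
by apply: (abmin (z, w)); rewrite inP zw zu wu.
Qed.

Lemma separation_gap (u : seq X) : exists2 e : R, 0 < e &
  forall x y, x \in u -> y \in u -> mdist x y < e -> x = y.
Proof.
have [[x [y [xu yu xy]]]|none] := pselect (exists x y, [/\ x \in u, y \in u & x != y]).
  have [a [b [_ _ ab abmin]]] := closest_pair xu yu xy.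
  exists (mdist a b); first by rewrite mdist_gt0.
  move=> z w zu wu; have [//|zw] := eqVneq z w.
  by rewrite ltNge abmin.
exists 1 => // x y xu yu _; apply/eqP/negPn/negP => xy; apply: none.
by exists x, y.
Qed.

(** The competitors of a finite set made of a pair and [Z]: the point [f] stands
    for the pair, and each [z] in [Z] is displaced to [g z]. *)
Definition merged (Z : seq X) (f : X) (g : X -> X) : set X := [set` f :: map g Z].

(** The conditions are symmetric in [a] and [b], so that what follows for [a]
    holds for [b] too. *)
Definition closest_pair_with_midpoint a b p (Z : seq X) (rho : R) : Prop :=
  [/\ 0 < rho, mdist a b = 2 * rho, mdist a p = rho, mdist p b = rho &
    forall z, z \in Z -> [/\ 2 * rho <= mdist a z, 2 * rho <= mdist b z &
      forall w, w \in Z -> z != w -> 2 * rho <= mdist z w]].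

Lemma closest_pair_with_midpoint_sym a b p (Z : seq X) (rho : R) :
  closest_pair_with_midpoint a b p Z rho -> closest_pair_with_midpoint b a p Z rho.
Proof.
move=> [rho0 ab ap pb sep]; split; rewrite // 1?metric_sym// => z /sep[? ? ?].
by split.
Qed.

Section FixedSingletons.
Context (J : set X -> set X).
Hypothesis J_compact : forall A, nonempty_compacts A -> nonempty_compacts (J A).
Hypothesis J_close : forall t A B, nonempty_compacts A -> nonempty_compacts B ->
  hausdorff_close t (J A) (J B) <-> hausdorff_close t A B.
Hypothesis J_surj : forall B, nonempty_compacts B ->
  exists2 A, nonempty_compacts A & J A = B.
Hypothesis J_single : forall x, J [set x] = [set x].

Section ClosestPair.
Context (a b p : X) (Z : seq X) (rho : R).
Hypothesis pair_mid : closest_pair_with_midpoint a b p Z rho.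

Let F := merged Z.
Let A : set X := [set` a :: b :: Z].
Let C : set X := J A.

Hypothesis F_fixed : forall f g, J (F f g) = F f g.

Let cA : nonempty_compacts A. Proof. exact: nonempty_compacts_seq. Qed.
Let cF f g : nonempty_compacts (F f g). Proof. exact: nonempty_compacts_seq. Qed.
Let cC : nonempty_compacts C. Proof. exact: J_compact. Qed.

Let lengths : [/\ 0 < rho, mdist a b = 2 * rho, mdist a p = rho,
  mdist p b = rho & mdist b p = rho].
Proof. by case: pair_mid => ? ? ? ? _; split=> //; rewrite metric_sym. Qed.

Let rho_ge0 : 0 <= rho. Proof. by apply: ltW; case: lengths. Qed.
Let ap : mdist a p = rho. Proof. by case: lengths. Qed.
Let bp : mdist b p = rho. Proof. by case: lengths. Qed.

Let Za z : z \in Z -> 2 * rho <= mdist a z.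
Proof. by case: pair_mid => _ _ _ _ sep /sep[]. Qed.

Let Zb z : z \in Z -> 2 * rho <= mdist b z.
Proof. by case: pair_mid => _ _ _ _ sep /sep[]. Qed.

Let ZZ z w : z \in Z -> w \in Z -> z != w -> 2 * rho <= mdist z w.
Proof. by case: pair_mid => _ _ _ _ sep /sep[_ _ +]; apply. Qed.

Let in_A x : A x <-> [\/ x = a, x = b | x \in Z].
Proof.
rewrite /A /= !inE; split=> [/or3P[/eqP->|/eqP->|xZ]|[->|->|->]];
  by [constructor 1|constructor 2|constructor 3|rewrite eqxx ?orbT|rewrite !orbT].
Qed.

Let in_F f g x : F f g x <-> x = f \/ exists2 z, z \in Z & x = g z.
Proof.
rewrite /F /merged /= inE; split=> [/orP[/eqP->|/mapP[z zZ ->]]|[->|[z zZ ->]]].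
- by left.
- by right; exists z.
- by rewrite eqxx.
- by rewrite map_f ?orbT.
Qed.

(** Otherwise [z] would be the antipode of [a] with respect to [p], which is
    [b]. *)
Lemma far_from_midpoint z : z \in Z -> rho < mdist p z.
Proof.
have [rho0 abE apE pbE bpE] := lengths.
move=> zZ; rewrite ltNge; apply/negP => pz.
have az := Za zZ; have := metric_triangle a p z; rewrite ap => apz.
have ap0 : a != p by rewrite -mdist_gt0 ap.
have bz : b = z by apply: (ext_unique ap0); lra.
by have := Zb zZ; rewrite bz mdistxx; lra.
Qed.

Lemma merged_close t f g : mdist a f <= t -> mdist b f <= t ->
  (forall z, z \in Z -> mdist z (g z) <= t) -> hausdorff_close t A (F f g).
Proof.
move=> af bf gt; split=> x.
- move=> /in_A[->|->|xZ].
  + by exists f; [apply/in_F; left|rewrite metric_sym].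
  + by exists f; [apply/in_F; left|rewrite metric_sym].
  + by exists (g x); [apply/in_F; right; exists x|rewrite metric_sym gt].
- move=> /in_F[->|[z zZ ->]].
  + by exists a => //; apply/in_A; constructor 1.
  + by exists z; [apply/in_A; constructor 3|exact: gt].
Qed.

Lemma image_close t f g : mdist a f <= t -> mdist b f <= t ->
  (forall z, z \in Z -> mdist z (g z) <= t) -> hausdorff_close t C (F f g).
Proof.
move=> af bf gt; rewrite -F_fixed; apply/J_close => //; exact: merged_close.
Qed.

(** Displacing every [z] by [rho] straight away from [c] leaves no point of the
    competitor near [c], unless [c] is near [p] or is one of the [z]. *)
Lemma image_subset c : C c -> mdist p c <= rho \/ c \in Z.
Proof.
have [rho0 abE apE pbE bpE] := lengths.
move=> Cc; have /choice[g gP] := fun z => extend c z rho_ge0.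
have [||z _|+ _] := @image_close rho p g; rewrite ?ap ?bp//.
  by have [->] := gP z.
move=> /(_ _ Cc)[y /in_F[->|[z zZ ->]] yc]; first by left.
right; suff -> : c = z by [].
have [_] := gP z; rewrite metric_sym => cgz.
by apply/mdist_positivity/eqP; rewrite eq_le mdist_ge0 andbT; lra.
Qed.

(** Displace [z] away from [p] by some [t < rho] so large that the new point is
    more than [2 * rho] from [p]. A point of the image within [rho] of it is not
    in the ball about [p], and points of [Z] other than [z] are too far away. *)
Lemma others_in_image z : z \in Z -> C z.
Proof.
have [rho0 abE apE pbE bpE] := lengths.
move=> zZ; have pz := far_from_midpoint zZ.
have [t [t0 trho tz]] : exists t, [/\ 0 <= t, t < rho & 2 * rho < mdist p z + t].
  have [pz2|pz2] := ltP (2 * rho) (mdist p z); first by exists 0; split; lra.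
  (* Half way between [2 * rho - mdist p z] and [rho]. *)
  by exists ((3 * rho - mdist p z) / 2); split; lra.
have /choice[g gP] := fun y => extend p y t0.
have [||y _|_] := @image_close rho p g; rewrite ?ap ?bp//.
  by have [-> _] := gP y; exact: ltW.
have [zgz pgz] := gP z.
move=> /(_ (g z))[|c Cc cgz]; first by apply/in_F; right; exists z.
have [pc|cZ] := image_subset Cc.
  by have := metric_triangle p c (g z); lra.
have [->//|zc] := eqVneq z c.
have := ZZ zZ cZ zc; have := metric_triangle z (g z) c.
by rewrite [mdist (g z) c]metric_sym; lra.
Qed.

Lemma image_near_midpoint : exists2 c, C c & mdist p c <= rho.
Proof.
have [rho0 abE apE pbE bpE] := lengths.
have [||y _|_] := @image_close rho p id; rewrite ?ap ?bp ?mdistxx//.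
move=> /(_ p)[|c Cc cp]; first by apply/in_F; left.
have [pc|cZ] := image_subset Cc; first by exists c.
by have := far_from_midpoint cZ; rewrite metric_sym; lra.
Qed.

(** Shift the midpoint by [s] towards [b]. This raises the distance from the
    finite set to the competitor to [rho + s], because of [a]. For the image
    this distance requires a point of the ball of radius [rho] about [p] which is
    at distance [rho + s] from the shifted midpoint, and only [a] is such. *)
Lemma endpoint_in_image : C a.
Proof.
have [rho0 abE apE pbE bpE] := lengths.
pose s := rho / 2; have s0 : 0 < s by rewrite /s; lra.
have [f [pf af]] := extend a p (ltW s0); rewrite ap in af.
have farA : hausdorff_far (rho + s) A (F f id).
  apply: (@hausdorff_far_intro _ _ _ _ _ a); first by apply/in_A; constructor 1.
  move=> y /in_F[->|[z zZ ->]]; first by rewrite af.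
  by have := Za zZ; rewrite /s; lra.
have farC : hausdorff_far (rho + s) C (F f id).
  move=> t /farA nc cl; apply: nc; apply/J_close => //.
  by rewrite F_fixed.
have eq_a c : mdist p c <= rho -> rho + s <= mdist c f -> c = a.
  move=> pc; rewrite metric_sym => fc.
  have [fp fa pa] : [/\ mdist f p = s, mdist f a = rho + s & mdist p a = rho].
    by split; rewrite metric_sym.
  have fp0 : f != p by rewrite -mdist_gt0 fp.
  have fpc := metric_triangle f p c; rewrite fp in fpc.
  by apply: (ext_unique fp0); rewrite ?fp ?fa ?pa; lra.
have [[c Cc farF]|[y /in_F[->|[z zZ ->]] yC]] := hausdorff_far_point cC (cF f id) farC.
- have cf : rho + s <= mdist c f by apply: farF; apply/in_F; left.
  have [pc|cZ] := image_subset Cc; first by rewrite -(eq_a c).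
  have : rho + s <= mdist c c by apply: farF; apply/in_F; right; exists c.
  by rewrite mdistxx; lra.
- have [c Cc pc] := image_near_midpoint.
  by rewrite -(eq_a c) // metric_sym yC.
- by have := yC _ (others_in_image zZ); rewrite mdistxx; lra.
Qed.

(** Let [f] be the antipode of [c] with respect to [p]. If [c] is neither [a] nor
    [b], these are closer to [f] than [c] is. Taking [f] for the pair and
    displacing all of [Z] away from [c], one gets a competitor closer to the
    finite set than to [c]. *)
Lemma image_on_sphere c : C c -> mdist p c = rho -> c = a \/ c = b.
Proof.
have [rho0 abE apE pbE bpE] := lengths.
move=> Cc pc; have [<-|ca] := eqVneq c a; first by left.
have [<-|cb] := eqVneq c b; first by right.
have [f [pf cf]] := extend c p rho_ge0.
have fp0 : f != p by rewrite -mdist_gt0 metric_sym pf.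
have near_f e : mdist e p = rho -> c != e -> mdist e f < 2 * rho.
  move=> ep ce; have epf := metric_triangle e p f; rewrite ep pf in epf.
  rewrite ltNge; apply/negP => ef; case/eqP: ce; apply: (ext_unique fp0).
  - by rewrite metric_sym cf [mdist f p]metric_sym pf [mdist c p]metric_sym; lra.
  - by rewrite metric_sym [mdist f p]metric_sym pf [mdist p e]metric_sym ep; lra.
  - by rewrite pc metric_sym.
have af := near_f a ap ca; have bf := near_f b bp cb.
pose t := Num.max rho (Num.max (mdist a f) (mdist b f)).
have [rt at_ bt] : [/\ rho <= t, mdist a f <= t & mdist b f <= t].
  by rewrite /t !le_max !lexx !orbT.
have t2 : t < 2 * rho by rewrite /t !gt_max af bf andbT; lra.
have t0 : 0 <= t by lra.
have /choice[g gP] := fun z => extend c z t0.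
have [z _|+ _] := @image_close t f g at_ bt; first by have [->] := gP z.
move=> /(_ _ Cc)[y /in_F[->|[z zZ ->]]]; rewrite metric_sym.
  by rewrite cf [mdist c p]metric_sym pc => tc; exfalso; lra.
have [_ ->] := gP z => cz; have c_z : c = z.
  by apply/mdist_positivity/eqP; rewrite eq_le mdist_ge0 andbT; lra.
by have := far_from_midpoint zZ; rewrite -c_z pc ltxx.
Qed.

(** Let [B] arise by moving [a], [b] to [p] and each [z] by [rho] away from [p].
    Points of [A] and of [B] are at distance at least [rho], so any set within
    [rho / 2] of both consists of midpoints of such pairs: it is a subset of the
    finite set [P], and two such sets that are close to each other coincide. If
    [c] in the image has distance less than [rho] to [p], the balls of radius
    [rho / 2] about [p] and [c] overlap. Then a set [M] within [rho / 2] of both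
    the image and [B], but avoiding the open ball of radius [rho / 2] about [p],
    may be completed by a point [x1] just inside this ball. Both [M] and its
    completion come from sets within [rho / 2] of [A] and [B]. *)
Lemma image_off_interior c : C c -> ~ mdist p c < rho.
Proof.
have [rho0 abE apE pbE bpE] := lengths.
move=> Cc pc.
pose r := rho / 2; have r0 : 0 < r by rewrite /r; lra.
have rhoE : rho = 2 * r by rewrite /r; lra.
have /choice[g gP] := fun z => extend p z rho_ge0.
set B := F p g; have cB : nonempty_compacts B by exact: cF.
have sep w y : A w -> B y -> rho <= mdist w y.
  move=> /in_A wA /in_F[->|[z zZ ->]].
    case: wA => [->|->|wZ]; rewrite ?ap ?bp// metric_sym.
    by rewrite ltW// far_from_midpoint.
  have [zgz _] := gP z.
  have [->|wz] := eqVneq w z; first by rewrite zgz.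
  have : 2 * rho <= mdist w z.
    by case: wA => [->|->|wZ]; [exact: Za|exact: Zb|exact: ZZ].
  by have := metric_triangle w (g z) z; rewrite [mdist (g z) z]metric_sym zgz; lra.
have /choice[m2 m2P] : forall wy : X * X, exists m, mdist wy.1 m = mdist wy.1 wy.2 / 2
    /\ mdist m wy.2 = mdist wy.1 wy.2 / 2 by move=> wy; exact: mid.
pose P := [seq m2 (w, y) | w <- a :: b :: Z, y <- p :: map g Z].
have in_P N x : hausdorff_close r N A -> hausdorff_close r N B -> N x -> x \in P.
  move=> [NA _] [NB _] Nx; have [w Aw wx] := NA _ Nx; have [y By yx] := NB _ Nx.
  have wy := sep _ _ Aw By; have wxy := metric_triangle w x y.
  rewrite [mdist y x]metric_sym in yx.
  have [m1 m3] := m2P (w, y); rewrite /= in m1 m3.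
  have -> : x = m2 (w, y) by apply: (@mid_unique w y); lra.
  exact: allpairs_f.
have [e e0 gap] := separation_gap P.
have mid_z z : z \in Z ->
    exists x, [/\ mdist z x <= r, mdist (g z) x <= r & r <= mdist x p].
  move=> zZ; have [x [zx xg]] := mid z (g z); have [zgz _] := gP z.
  have pz := far_from_midpoint zZ; exists x.
  rewrite [mdist (g z) x]metric_sym xg zx zgz.
  have := metric_triangle p x z; rewrite [mdist p x]metric_sym [mdist x z]metric_sym.
  by rewrite zx zgz => pxz; split; lra.
(* The largest set within [r] of the image and [B] that avoids the open ball of
   radius [r] about [p]: what it loses can be moved out along rays from [p]. *)
pose M := neighborhood r C `&` neighborhood r B `&` [set x | r <= mdist x p].
have Bp : B p by apply/in_F; left.
have ray_M k : C k -> mdist p k <= rho ->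
    exists2 x, M x & mdist p x = r /\ mdist k x <= r.
  move=> Ck pk; have [x [px xk]] := ray_point p k (ltW r0); exists x.
    split; last by rewrite /= metric_sym px.
    split; last by exists p => //; rewrite px.
    exists k => //; rewrite metric_sym xk.
    by have := mdist_ge0 p k; rewrite ler_norml; lra.
  by split=> //; rewrite metric_sym xk; have := mdist_ge0 p k; rewrite ler_norml; lra.
have mid_M z : z \in Z -> exists2 x, M x & mdist z x <= r /\ mdist (g z) x <= r.
  move=> zZ; have [x [zx gx xp]] := mid_z z zZ; exists x => //; split=> //.
  split; first by exists z => //; exact: others_in_image.
  by exists (g z) => //; apply/in_F; right; exists z.
have [x0 Mx0 _] := ray_M c Cc (ltW pc).
have cM : nonempty_compacts M.
  split; first by exists x0.
  apply: (@compact_in_neighborhood _ _ X_proper r C) => //; last by move=> x [[]].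
  by repeat apply: closedI;
    [exact: closed_neighborhood|exact: closed_neighborhood|exact: closed_far_from].
have CM : C `<=` neighborhood r M.
  move=> k Ck; have [pk|kZ] := image_subset Ck.
    by have [x Mx [_ kx]] := ray_M _ Ck pk; exists x => //; rewrite metric_sym.
  by have [x Mx [kx _]] := mid_M _ kZ; exists x => //; rewrite metric_sym.
have BM : B `<=` neighborhood r M.
  move=> y /in_F[->|[z zZ ->]].
    have [x Mx [px _]] := ray_M c Cc (ltW pc).
    by exists x => //; rewrite metric_sym px.
  by have [x Mx [_ gx]] := mid_M _ zZ; exists x => //; rewrite metric_sym.
(* [x1] is moved by [s] from the point [h r] of [M] towards [p]; it stays within
   [r] of [c] as long as [s <= rho - mdist p c]. *)
have [h [dh hp hc]] := line p c; have pc0 := mdist_ge0 p c.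
have [s [s0 sr se sc]] : exists s, [/\ 0 < s, s <= r, s < e & s <= rho - mdist p c].
  exists (Num.min r (Num.min (e / 2) (rho - mdist p c))).
  rewrite !lt_min !ge_min !gt_min !lexx !orbT r0 /=; split=> //.
    by apply/andP; split; lra.
  by apply/orP; right; apply/orP; left; lra.
pose x1 := h (r - s).
have px1 : mdist p x1 = r - s by rewrite -hp dh sub0r normrN ger0_norm ?subr_ge0.
have cx1 : mdist c x1 <= r.
  by rewrite -hc dh ler_norml; lra.
have Mhr : M (h r).
  have phr : mdist p (h r) = r by rewrite -hp dh sub0r normrN ger0_norm ?ltW.
  split; last by rewrite /= metric_sym phr.
  split; last by exists p => //; rewrite phr.
  by exists c => //; rewrite -[X in mdist X]hc dh ler_norml; lra.
pose M' := M `|` [set x1].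
have cM' : nonempty_compacts M'.
  split; first by exists x1; right.
  by apply: compactU; [exact: cM.2|exact: compact_set1].
have [N cN NM] := J_surj cM; have [N' cN' N'M'] := J_surj cM'.
have JB : J B = B by exact: F_fixed.
have close_M D : D `<=` neighborhood r M -> M `<=` neighborhood r D ->
   forall d, D d -> mdist d x1 <= r -> hausdorff_close r M D /\ hausdorff_close r M' D.
  move=> DM MD d Dd dx1; split; split=> //.
    by move=> x [/MD//|->]; exists d.
  by move=> x /DM[k Mk kx]; exists k => //; left.
have [MC M'C] : hausdorff_close r M C /\ hausdorff_close r M' C.
  by apply: (close_M _ CM _ c) => // x [[]].
have [MB M'B] : hausdorff_close r M B /\ hausdorff_close r M' B.
  by apply: (close_M _ BM _ p) => // [x [[]]//|]; rewrite px1; lra.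
have MM' : hausdorff_close s M M'.
  split=> [x Mx|x [Mx|->]].
  - by exists x; [left|rewrite mdistxx ltW].
  - by exists x => //; rewrite mdistxx ltW.
  - by exists (h r) => //; rewrite dh ger0_norm; lra.
have NA : hausdorff_close r N A by apply/J_close => //; rewrite NM.
have N'A : hausdorff_close r N' A by apply/J_close => //; rewrite N'M'.
have NB : hausdorff_close r N B by apply/J_close => //; rewrite NM JB.
have N'B : hausdorff_close r N' B by apply/J_close => //; rewrite N'M' JB.
have NN' : hausdorff_close s N N' by apply/J_close => //; rewrite NM N'M'.
have sub D E : hausdorff_close s D E ->
    hausdorff_close r D A -> hausdorff_close r D B ->
    hausdorff_close r E A -> hausdorff_close r E B -> D `<=` E.
  move=> [DE _] DA DB EA EB x Dx; have [y Ey yx] := DE _ Dx.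
  suff -> : x = y by [].
  apply/esym/gap; [exact: (in_P E)|exact: (in_P D)|exact: le_lt_trans yx se].
have NE : N = N'.
  apply/seteqP; split; apply: sub => //; exact: hausdorff_close_sym.
have : M x1 by rewrite -NM NE N'M'; right.
by move=> [_ /=]; rewrite metric_sym px1; lra.
Qed.

End ClosestPair.

(** The induction is on the length of a list; repetitions are removed first, so
    that merging a closest pair does shorten it. *)
Lemma finite_sets_fixed x (u : seq X) : J [set` x :: u] = [set` x :: u].
Proof.
have [n] := ubnP (size (x :: u)).
elim: n x u => // n IH x u; rewrite ltnS => size_n.
have [/all_pred1P all_x|/allPn[y yu yx]] := boolP (all (pred1 x) u).
  have -> : [set` x :: u] = [set x].
    apply/seteqP; split=> [y /=|_ ->]; last by rewrite /= mem_head.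
    by rewrite all_x inE mem_nseq => /orP[/eqP|/andP[_ /eqP]].
  exact: J_single.
pose v := undup (x :: u).
have mem_v z : (z \in v) = (z \in x :: u) by rewrite mem_undup.
have vE : [set` x :: u] = [set` v] by apply/seteqP; split=> z /=; rewrite mem_v.
have [|||a [b [av bv ab abmin]]] := @closest_pair v x y.
- by rewrite mem_v mem_head.
- by rewrite mem_v inE yu orbT.
- by rewrite eq_sym.
have uniq_v : uniq v by exact: undup_uniq.
have b_rem : b \in rem a v by rewrite mem_rem_uniq// !inE eq_sym ab.
pose Z := rem b (rem a v).
have perm_v : perm_eq v (a :: b :: Z).
  by rewrite (perm_trans (perm_to_rem av))// perm_cons perm_to_rem.
have mem_abZ z : (z \in v) = (z \in a :: b :: Z) by exact: perm_mem.
have {}vE : [set` x :: u] = [set` a :: b :: Z].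
  by rewrite vE; apply/seteqP; split=> z /=; rewrite mem_abZ.
have size_Z : (size (a :: b :: Z) <= n)%N.
  by rewrite -(perm_size perm_v); apply: leq_trans size_n; exact: size_undup.
have Zv z : z \in Z -> z \in v by rewrite mem_abZ !inE => ->; rewrite !orbT.
move: (uniq_v); rewrite (perm_uniq perm_v) /= !inE negb_or => /and3P[/andP[_ aZ] bZ _].
have [p [ap pb]] := midpoint X_uniquely_geodesic X_geodesically_complete a b.
have F_fixed f g : J (merged Z f g) = merged Z f g.
  by apply: IH; rewrite /= size_map.
pose rho := mdist a b / 2.
have rho0 : 0 < rho by rewrite divr_gt0// mdist_gt0.
have abE : mdist a b = 2 * rho by rewrite /rho; lra.
have pair_mid : closest_pair_with_midpoint a b p Z rho.
  split=> // z zZ; rewrite -abE; split.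
  - by apply: (abmin a z av (Zv _ zZ)); apply: contraNneq aZ => ->.
  - by apply: (abmin b z bv (Zv _ zZ)); apply: contraNneq bZ => ->.
  - by move=> w wZ; exact: abmin (Zv _ zZ) (Zv _ wZ).
rewrite vE; apply/seteqP; split=> c.
- move=> Cc; rewrite /= !inE.
  have [pc|->] := image_subset pair_mid F_fixed Cc; last by rewrite !orbT.
  have [pc_lt|pc_ge] := ltP (mdist p c) rho.
    by have := image_off_interior pair_mid F_fixed Cc pc_lt.
  have pcE : mdist p c = rho by apply/eqP; rewrite eq_le pc.
  have [->|->] := image_on_sphere pair_mid F_fixed Cc pcE;
    by rewrite eqxx ?orbT.
- have baE : [set` a :: b :: Z] = [set` b :: a :: Z].
    by apply/seteqP; split=> z /=; rewrite !inE orbCA.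
  rewrite /= !inE => /or3P[/eqP->|/eqP->|cZ].
  + exact: (endpoint_in_image pair_mid F_fixed).
  + rewrite baE.
    exact: (endpoint_in_image (closest_pair_with_midpoint_sym pair_mid) F_fixed).
  + exact: (others_in_image pair_mid F_fixed).
Qed.

Lemma fixed_compact C : nonempty_compacts C -> J C = C.
Proof.
move=> cC; apply: hausdorff_close_eq => // [|e e0]; first exact: J_compact.
have e20 : 0 < e / 2 by lra.
have [x [u CF]] := finite_net cC e20.
have JCF : hausdorff_close (e / 2) (J C) [set` x :: u].
  by rewrite -finite_sets_fixed; apply/J_close => //; exact: nonempty_compacts_seq.
have chain A B D s t : A `<=` neighborhood s B -> B `<=` neighborhood t D ->
    A `<=` neighborhood (s + t) D.
  move=> AB BD z /AB[y /BD[w Dw wy] yz]; exists w => //.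
  by have := metric_triangle w y z; lra.
have [CF1 CF2] := CF; have [JC1 JC2] := JCF.
by rewrite [e]splitr; split; [exact: chain JC1 CF2|exact: chain CF1 JC2].
Qed.

End FixedSingletons.

End FiniteSets.

(** * Isometries of the hyperspace *)

Lemma hausdorff_close1 (R : realType) (X : metricType R) t (x y : X) :
  hausdorff_close t [set x] [set y] <-> mdist x y <= t.
Proof.
split=> [[_ /(_ y erefl)[_ -> ]]//|xy].
by split=> _ ->; [exists y; rewrite // metric_sym|exists x].
Qed.

Lemma hausdorff_close_image (R : realType) (X : metricType R) (k : X -> X) :
  (forall x y, mdist (k x) (k y) = mdist x y) ->
  forall t A B, hausdorff_close t (k @` A) (k @` B) <-> hausdorff_close t A B.
Proof.
move=> dk t A B.
have one A' B' : (k @` A' `<=` neighborhood t (k @` B')) <-> A' `<=` neighborhood t B'.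
  split=> sub.
    move=> x A'x; have [|_ [y B'y <-] yx] := sub (k x); first by exists x.
    by exists y; rewrite // -dk.
  by move=> _ [x /sub[y B'y yx] <-]; exists (k y); [exists y|rewrite dk].
by split=> -[AB BA]; split; apply/one.
Qed.

Lemma nonempty_compacts_image (R : realType) (X : metricType R) (k : X -> X) :
  (forall x y, mdist (k x) (k y) = mdist x y) ->
  forall A, nonempty_compacts A -> nonempty_compacts (k @` A).
Proof.
move=> dk A [[a Aa] cA]; split; first by exists (k a), a.
apply: continuous_compact cA; apply: continuous_subspaceT => x.
apply/metricType_numDomainType.cvgrPdist_lt => e e0; near=> y; rewrite dk.
by near: y; apply/metricType_numDomainType.nbhs_mdistP; exists e.
Unshelve. all: by end_near.
Qed.

Theorem theorem2 (R : realType) (X : metricType R)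
    (X_proper : proper_space X)
    (X_uniquely_geodesic : uniquely_geodesic_space X)
    (X_geodesically_complete : geodesically_complete X)
    (X_no_split : geodesics_do_not_split X)
    (I : set X -> set X)
    (I_isometry : onto_isometry (@hausdorff_dist R X) (@nonempty_compacts R X) I) :
  exists2 i : X -> X,
    onto_isometry (@mdist R X) setT i
    & forall C : set X, nonempty_compacts C -> I C = i @` C.
Proof.
have [I_compact I_dist I_surj] := I_isometry.
have I_close t A B : nonempty_compacts A -> nonempty_compacts B ->
    hausdorff_close t (I A) (I B) <-> hausdorff_close t A B.
  move=> cA cB; have := hausdorff_distP t cA cB.
  have := hausdorff_distP t (I_compact _ cA) (I_compact _ cB).
  by rewrite I_dist ?inE// => -> ->.
have I_far t A B : nonempty_compacts A -> nonempty_compacts B ->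
    hausdorff_far t (I A) (I B) <-> hausdorff_far t A B.
  by move=> cA cB; split=> far s /far + cl; apply; apply/I_close.
have I_crowded A : nonempty_compacts A -> crowded (I A) <-> crowded A.
  move=> cA; split=> -[r [U [r0 cU clU farU]]]; last first.
    exists r, (I \o U); split=> // [i|i|i j ij] /=; first exact: I_compact.
      exact/I_close.
    by apply/I_far => //; exact: farU.
  have /choice[V VP] : forall i, exists V, nonempty_compacts V /\ I V = U i.
    by move=> i; have [V cV VU] := I_surj _ (cU i); exists V.
  exists r, V; split=> // [i|i|i j ij]; have [cV VU] := VP i => //.
    by apply/I_close => //; rewrite VU.
  by have [cVj VUj] := VP j; apply/I_far => //; rewrite VU VUj; exact: farU.
have not_crowded (A : set X) : nonempty_compacts A -> ~ crowded A ->
    exists x, A = [set x].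
  move=> cA ncA; have [[x Ax] _] := cA; exists x; apply/seteqP; split=> [y Ay|_ -> //].
  apply/eqP/negPn/negP => yx; apply: ncA.
  by apply: (crowded_of_two_points X_proper X_uniquely_geodesic
    X_geodesically_complete cA Ay Ax yx).
have not_crowded1 (x : X) : ~ crowded [set x] by exact: singleton_not_crowded.
have /choice[i iP] : forall x, exists y, I [set x] = [set y].
  move=> x; apply: not_crowded; first exact/I_compact/nonempty_compacts1.
  by move=> /(I_crowded _ (nonempty_compacts1 x))/not_crowded1.
have di x y : mdist (i x) (i y) = mdist x y.
  have le t : mdist (i x) (i y) <= t <-> mdist x y <= t.
    rewrite -!hausdorff_close1 -!iP.
    exact: I_close (nonempty_compacts1 x) (nonempty_compacts1 y).
  by apply/eqP; rewrite eq_le; apply/andP; split; apply/le.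
have /choice[k ik] : forall y, exists x, i x = y.
  move=> y; have [A cA IA] := I_surj _ (nonempty_compacts1 y).
  have [|x Ax] := not_crowded A cA; first by rewrite -I_crowded// IA.
  by exists x; move: IA; rewrite Ax iP => /seteqP[/(_ _ erefl)].
have i_inj x y : i x = i y -> x = y.
  by move=> ixy; apply: mdist_positivity; rewrite -di ixy mdistxx.
have ki x : k (i x) = x by apply: i_inj; rewrite ik.
have dk x y : mdist (k x) (k y) = mdist x y by rewrite -di !ik.
have ik_image (A : set X) : i @` (k @` A) = A.
  apply/seteqP; split=> [_ [_ [x Ax <-] <-]|x Ax]; first by rewrite ik.
  by exists (k x); [exists x|exact: ik].
have ki_image (A : set X) : k @` (i @` A) = A.
  apply/seteqP; split=> [_ [_ [x Ax <-] <-]|x Ax]; first by rewrite ki.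
  by exists (i x); [exists x|exact: ki].
exists i; first split=> //.
  by move=> y _; exists (k y).
move=> C cC; rewrite -[LHS]ik_image; congr (i @` _).
apply: (@fixed_compact _ _ X_proper X_uniquely_geodesic
  X_geodesically_complete X_no_split (fun A => k @` I A)) cC.
- by move=> A cA; apply: nonempty_compacts_image => //; exact: I_compact.
- by move=> t A B cA cB; rewrite hausdorff_close_image//; exact: I_close.
- move=> B cB; have [A cA IA] := I_surj _ (nonempty_compacts_image di cB).
  by exists A; rewrite // IA ki_image.
- by move=> x; rewrite iP image_set1 ki.
Qed.
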